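(* Let $X$ be a strictly convex real Banach space with $\dim X\ge 2$ and let $0<\lambda<1$. If $x,y\in S_X$ and $x\perp_B y$, then $$\min\{\|\lambda x+(1-\lambda)y\|,\ \|\lambda x-(1-\lambda)y\|\}<1.$$
   Context: For a real Banach space $X$, $S_X=\{x\in X:\|x\|=1\}$. For $x,y\in X$, $x\perp_B y$ (Birkhoff--James orthogonality) means $\|x\|\le\|x+ty\|$ for every $t\in\mathbb R$. *)

(* Defs.v *)
From HB Require Import structures.
From mathcomp Require Import all_boot all_order all_algebra.
From mathcomp Require Import all_classical all_reals all_analysis.

Set Implicit Arguments.
Unset Strict Implicit.
Unset Printing Implicit Defensive.

Import Order.TTheory GRing.Theory Num.Theory.
Import numFieldNormedType.Exports.

Local Open Scope classical_set_scope.
Local Open Scope ring_scope.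

Definition unit_sphere (R : realType) (X : normedModType R) : set X :=
  [set x | `|x| = 1].

Definition bj_orthogonal (R : realType) (X : normedModType R) (x y : X) : Prop :=
  forall t : R, `|x| <= `|x + t *: y|.

Definition strictly_convex (R : realType) (X : normedModType R) : Prop :=
  forall x y : X, unit_sphere x -> unit_sphere y -> x <> y ->
    `|2^-1 *: (x + y)| < 1.

(* The dimension may be infinite, so "dim V >= n" is expressed by the
   existence of n linearly independent vectors. *)
Definition dim_ge (R : realType) (V : lmodType R) (n : nat) : Prop :=
  exists e : 'I_n -> V, forall c : 'I_n -> R,
    \sum_(i < n) c i *: e i = 0 -> forall i, c i = 0.

(* Main.v *)
Require Import Defs.
From HB Require Import structures.
From mathcomp Require Import all_boot all_order all_algebra.
From mathcomp Require Import all_classical all_reals all_analysis.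
From mathcomp Require Import ring lra.

(** Orthogonality forces [x] and [y] to be distinct: taking [t = -1] in
    [bj_orthogonal x y] gives [1 <= `|x - y|].  Strict convexity, stated for
    midpoints, says that the open segment between two distinct unit vectors
    lies in the open unit ball ([strictly_convex_segment]); hence the first of
    the two norms is already smaller than 1. *)

Set Implicit Arguments.
Unset Strict Implicit.
Unset Printing Implicit Defensive.

Import Order.TTheory GRing.Theory Num.Theory.
Import numFieldNormedType.Exports.

Local Open Scope classical_set_scope.
Local Open Scope ring_scope.

(** A point of the half of the segment [[x, y]] next to [y] is a convex
    combination of [y], of norm 1, and of the midpoint, of norm smaller than 1,
    in which the midpoint has the positive weight [2 * a]. *)
Lemma strictly_convex_half_segment (R : realType) (X : normedModType R)
    (x y : X) (a : R) :
  strictly_convex X -> unit_sphere x -> unit_sphere y -> x <> y ->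
  0 < a -> a <= 2^-1 -> `|a *: x + (1 - a) *: y| < 1.
Proof.
move=> sX hx hy xy a0 a1.
have mid := sX x y hx hy xy.
have -> : a *: x + (1 - a) *: y
    = (2 * a) *: (2^-1 *: (x + y)) + (1 - 2 * a) *: y.
  have half : 2 * a * 2^-1 = a by field.
  rewrite scalerA half scalerDr -addrA -scalerDl.
  by congr (_ + _ *: _); ring.
apply: le_lt_trans (ler_normD _ _) _.
rewrite [`|(1 - _) *: _|]normrZ [`|(2 * a) *: _|]normrZ (hy : `|y| = 1).
rewrite !ger0_norm; [nra | lra | lra].
Qed.

Lemma strictly_convex_segment (R : realType) (X : normedModType R)
    (x y : X) (a : R) :
  strictly_convex X -> unit_sphere x -> unit_sphere y -> x <> y ->
  0 < a -> a < 1 -> `|a *: x + (1 - a) *: y| < 1.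
Proof.
move=> sX hx hy xy a0 a1.
have [ah|ah] := leP a 2^-1; first exact: strictly_convex_half_segment.
have -> : a *: x + (1 - a) *: y = (1 - a) *: y + (1 - (1 - a)) *: x.
  by rewrite addrC subKr.
by apply: strictly_convex_half_segment => //; [exact: nesym | lra | lra].
Qed.

Lemma bj_orthogonal_neq (R : realType) (X : normedModType R) (x y : X) :
  unit_sphere x -> bj_orthogonal x y -> x <> y.
Proof.
move=> hx hxy xy; have := hxy (-1).
by rewrite -xy scaleN1r subrr normr0 (hx : `|x| = 1) ler10.
Qed.

Theorem proposition3p10 (R : realType) (X : completeNormedModType R)
    (hX : strictly_convex X) (hdim : dim_ge X 2)
    (lambda : R) (hlambda0 : 0 < lambda) (hlambda1 : lambda < 1)
    (x y : X) (hx : unit_sphere x) (hy : unit_sphere y)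
    (hxy : bj_orthogonal x y) :
  Num.min `|lambda *: x + (1 - lambda) *: y|
          `|lambda *: x - (1 - lambda) *: y| < 1.
Proof.
rewrite gt_min strictly_convex_segment //.
exact: bj_orthogonal_neq hx hxy.
Qed.
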